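(* Let $\Gamma$ be a metric graph and fix a combinatorial model $G$ for $\Gamma$. Let $\mathrm{ST}$ be a spanning tree of $G$ with root $q$, and let $\mathbf V$ and $\mathbf Q$ be the associated matrices. (i) Change the root of $\mathrm{ST}$ to another vertex $q'\ne q$, and let $\widetilde{\mathbf V}$, $\widetilde{\mathbf Q}$ be the matrices associated with $\mathrm{ST}$ rooted at $q'$. Then $\widetilde{\mathbf Q}=\mathbf Q$ and there exists a column vector $\mathbf a\in\mathbb R^g$ such that $$\widetilde{\mathbf V}=\mathbf V+\mathbf a\mathbf 1^\top,$$ where $\mathbf 1$ is the column vector of all ones. (ii) Let $\mathrm{ST}'$ be another spanning tree of $G$ with the same root as $\mathrm{ST}$, and let $\widetilde{\mathbf V}$, $\widetilde{\mathbf Q}$ be the matrices associated with $\mathrm{ST}'$. Then there exists $\mathbf P\in\mathrm{GL}(g;\mathbb Z)$ such that $$\widetilde{\mathbf Q}=\mathbf P\mathbf Q\mathbf P^\top,$$ and there exists an integer matrix $\mathbf B\in\mathbb Z^{n_G\times g}$ such that $$\mathbf P^{-1}\widetilde{\mathbf V}=\mathbf V+\mathbf Q\mathbf B^\top.$$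
   Context: Graphs. A combinatorial graph $G$ is a finite directed multigraph (loops and multiple edges allowed) with vertex set $V(G)$ and edge multiset $E(G)$; each edge $e$ has an initial vertex $e_-$ and a terminal vertex $e_+$. A metric graph $\Gamma$ is a compact topological graph with a length metric. A combinatorial model of $\Gamma$ is a combinatorial graph $G$ with edge lengths $\ell:E(G)\to\mathbb R_{>0}$ such that gluing intervals $[0,\ell(e)]$ along the vertices yields $\Gamma$ isometrically. All graphs are connected and every point has valence at least $2$. Put $n_G=|V(G)|$, $m_G=|E(G)|$, and genus $g=m_G-n_G+1$. The vertices $p_1,\dots,p_{n_G}$ and edges $e_1,\dots,e_{m_G}$ are numbered once and for all. Matrices. $C_1(G;\mathbb Z)$ denotes integral 1-chains; for a chain $\alpha$, $\alpha(e)$ is its coefficient at $e$. Given a spanning tree $\mathrm{ST}$ with root $q$, each of the $g$ edges outside $\mathrm{ST}$ determines a fundamental 1-cycle: the unique simple cycle in $\mathrm{ST}$ plus that edge, viewed as an element of $H_1(G;\mathbb Z)$ and oriented consistently with that edge. Let $\sigma_1,\dots,\sigma_g$ be these cycles in some chosen order depending only on the (unrooted) tree, and, for each vertex $p_i$, let $\gamma_i\in C_1(G;\mathbb Z)$ be the unique path in $\mathrm{ST}$ from $q$ to $p_i$. Define $\mathbf C\in\mathbb Z^{g\times m_G}$, $\mathbf C[i,j]=\sigma_i(e_j)$; $\mathbf Y\in\mathbb Z^{n_G\times m_G}$, $\mathbf Y[i,j]=\gamma_i(e_j)$; $\mathbf L=\mathrm{diag}(\ell(e_1),\dots,\ell(e_{m_G}))$.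 The matrices associated with the rooted spanning tree are $$\mathbf V=\mathbf C\mathbf L\mathbf Y^\top\in\mathbb R^{g\times n_G},\qquad \mathbf Q=\mathbf C\mathbf L\mathbf C^\top\in\mathbb R^{g\times g}.$$ $\mathrm{GL}(g;\mathbb Z)$ is the group of integer matrices with integer inverse. *)

(* Defs.v *)
From HB Require Import structures.
From mathcomp Require Import all_boot all_order all_algebra.
From mathcomp Require Import boolp classical_sets reals topology.

Set Implicit Arguments.
Unset Strict Implicit.
Unset Printing Implicit Defensive.

Import Order.TTheory GRing.Theory Num.Theory.
Local Open Scope ring_scope.

(* Finite directed multigraphs; loops and parallel edges are allowed, and the
   vertices and edges come numbered. *)
Record graph := Graph {
  nV : nat;
  nE : nat;
  src : 'I_nE -> 'I_nV;
  tgt : 'I_nE -> 'I_nV }.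

Notation vertex G := 'I_(nV G).
Notation edge G := 'I_(nE G).

(* Truncation is harmless: a connected graph has nV <= nE + 1. *)
Definition genus (G : graph) : nat := ((nE G).+1 - nV G)%N.

(* An edge together with a direction of travel; [true] is the direction of the
   edge itself. *)
Notation dart G := (edge G * bool)%type.

(* C_1(G; Z) *)
Notation chain G := 'rV[int]_(nE G).

Section Combinatorial.
Variable G : graph.
Implicit Types (S T : {set edge G}) (u v q : vertex G) (w : seq (dart G)).

Definition dsrc (d : dart G) : vertex G := if d.2 then src d.1 else tgt d.1.
Definition dtgt (d : dart G) : vertex G := if d.2 then tgt d.1 else src d.1.

(* A loop contributes two darts, hence counts twice. *)
Definition valence v : nat := #|[set d : dart G | dsrc d == v]|.

Fixpoint walk S u w v : bool :=
  if w is d :: w' then [&& d.1 \in S, dsrc d == u & walk S (dtgt d) w' v]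
  else u == v.

Definition simple_path S u w v : bool :=
  walk S u w v && uniq (u :: map dtgt w).

(* Distinctness of the edges is not implied by that of the vertices: it rules
   out going forth and back along a single edge. *)
Definition simple_cycle S u w : bool :=
  [&& w != [::], walk S u w u, uniq (map dtgt w) & uniq (map fst w)].

Definition connected_on S : Prop := forall u v, exists w, walk S u w v.

Definition spanning_tree T : Prop :=
  connected_on T /\ forall u w, ~~ simple_cycle T u w.

Definition chain_of w : chain G :=
  \row_e \sum_(d <- w | d.1 == e) (if d.2 then 1 else -1).

Definition is_tree_path T q v (c : chain G) : Prop :=
  exists2 w, simple_path T q w v & c = chain_of w.

Definition is_fund_cycle T (e : edge G) (c : chain G) : Prop :=
  exists u w, [/\ simple_cycle (e |: T) u w, (e, true) \in w & c = chain_of w].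

(* A choice, for every unrooted spanning tree, of an order on the edges outside
   that tree, i.e. on its fundamental cycles. *)
Definition cotree_order (o : {set edge G} -> 'I_(genus G) -> edge G) : Prop :=
  forall T, spanning_tree T ->
    injective (o T) /\ forall e, (e \notin T) <-> exists i, o T i = e.

Variables (R : realType) (l : edge G -> R).
Variable o : {set edge G} -> 'I_(genus G) -> edge G.

Definition Lmx : 'M[R]_(nE G) := diag_mx (\row_j l j).

(* [V] and [Q] are the matrices associated with the tree [T] rooted at [q]; for
   a spanning tree, [C] and [Y], hence [V] and [Q], exist and are unique. *)
Definition associated_mx T q
    (V : 'M[R]_(genus G, nV G)) (Q : 'M[R]_(genus G)) : Prop :=
  exists (C : 'M[int]_(genus G, nE G)) (Y : 'M[int]_(nV G, nE G)),
    [/\ forall i, is_fund_cycle T (o T i) (row i C),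
        forall i, is_tree_path T q i (row i Y),
        V = map_mx intr C *m Lmx *m (map_mx intr Y)^T
      & Q = map_mx intr C *m Lmx *m (map_mx intr C)^T].

End Combinatorial.

Section MetricGraph.
Variables (R : realType) (G : graph) (l : edge G -> R).

(* [(e, t)] stands for the point at distance [t] from the initial vertex of [e]
   in the interval [0, l e]. *)
Definition in_edge (x : edge G * R) : Prop := 0 <= x.2 <= l x.1.

Definition at_vertex (x : edge G * R) (v : vertex G) : Prop :=
  (x.2 = 0 /\ v = src x.1) \/ (x.2 = l x.1 /\ v = tgt x.1).

Definition glued (x y : edge G * R) : Prop :=
  x = y \/ exists v, at_vertex x v /\ at_vertex y v.

(* [(e, (s, t))] is the segment from [(e, s)] to [(e, t)]. *)
Fixpoint broken_path (x : edge G * R) (p : seq (edge G * (R * R)))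
    (y : edge G * R) : Prop :=
  if p is (e, (s, t)) :: p' then
    [/\ in_edge (e, s), in_edge (e, t), glued x (e, s)
      & broken_path (e, t) p' y]
  else glued x y.

Definition broken_length (p : seq (edge G * (R * R))) : R :=
  \sum_(a <- p) `|a.2.2 - a.2.1|.

Definition glued_dist (x y : edge G * R) : R :=
  inf [set broken_length p | p in [set p | broken_path x p y]]%classic.

(* [Gamma] is isometric to the space obtained by gluing the intervals [0, l e]
   along the vertices of [G], with the quotient (length) metric.  Such a space
   is automatically a compact topological graph. *)
Definition combinatorial_model (Gamma : metricType R) : Prop :=
  (forall e, 0 < l e) /\
  exists phi : edge G * R -> Gamma,
    (forall z, exists2 x, in_edge x & phi x = z) /\
    (forall x y, in_edge x -> in_edge y ->
       mdist (phi x) (phi y) = glued_dist x y).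

End MetricGraph.

(* Main.v *)
(* A chain supported in a spanning tree T and with zero boundary vanishes: for e
   in T, its value at e is the pairing of its boundary with the indicator of the
   component of tgt e in T minus e.  Hence tree paths and fundamental cycles are
   determined by their boundaries and their values off T, and a 1-cycle z equals
   z *m S *m C, where S selects the edges outside T.  For two trees this gives
   P = C' *m S, with inverse C *m S', and B = (Y' - Y) *m S. *)
Require Import Defs.
From HB Require Import structures.
From mathcomp Require Import all_boot all_order all_algebra.
From mathcomp Require Import boolp classical_sets reals topology.

Import Order.TTheory GRing.Theory Num.Theory.
Local Open Scope ring_scope.

Set Implicit Arguments.
Unset Strict Implicit.

(** * Walks, simple paths and boundaries of chains *)

Lemma walk_cat (G : graph) (S : {set edge G}) u w1 w2 v x :
  walk S u w1 x -> walk S x w2 v -> walk S u (w1 ++ w2) v.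
Proof.
elim: w1 u => [|d w1 IH] u /=; first by move=> /eqP ->.
by move=> /and3P[-> -> /IH]; apply.
Qed.

(** Induction on the walk: its first edge is prepended to a simple path for the rest, unless [u]
    already lies on that path, in which case the part of the path from [u] on is kept. *)
Lemma walk_simple_path (G : graph) (S : {set edge G}) u w v :
  walk S u w v -> exists w', simple_path S u w' v.
Proof.
have suffix x y p : simple_path S x p v -> y \in x :: map (@dtgt G) p ->
    exists p', simple_path S y p' v.
  elim: p x => [|d p IH] x.
    by rewrite inE => xv /eqP ->; exists [::].
  move=> xv; rewrite inE => /predU1P[->|ymem]; first by exists (d :: p).
  apply: (IH (dtgt d)) => //; move: xv.
  by rewrite /simple_path /= => /andP[/and3P[_ _ ->] /andP[_ ->]].
elim: w u => [|d w IH] u; first by move=> uv; exists [::]; rewrite /simple_path uv.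
move=> /= /and3P[dS du /IH[p pP]].
have [umem|uN] := boolP (u \in dtgt d :: map (@dtgt G) p).
  exact: suffix pP umem.
exists (d :: p); move: pP; rewrite /simple_path /= dS du => /andP[-> up].
by move: uN up => /= -> ->.
Qed.

(** Travelling an edge twice repeats a vertex: its end if both passages have the same direction, its
    start if they are opposite. *)
Lemma simple_path_uniq_edges (G : graph) (S : {set edge G}) u w v :
  simple_path S u w v -> uniq (map fst w).
Proof.
elim: w u => // d w IH u /andP[/= /and3P[dS /eqP du wv] /andP[uN dw]].
rewrite (IH (dtgt d)) ?andbT; last by rewrite /simple_path wv.
apply/mapP => -[d' d'w ed].
have d'mem : dtgt d' \in map (@dtgt G) w by apply: map_f.
case: (d.2 =P d'.2) => [bd|/eqP bd].
  case/andP: dw => /negP[].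
  by rewrite [d]surjective_pairing ed bd -surjective_pairing.
move: uN; rewrite inE negb_or => /andP[_ /negP[]]; rewrite -du.
suff -> : dsrc d = dtgt d' by [].
by move: bd; rewrite /dsrc /dtgt ed; case: d.2; case: d'.2.
Qed.

(** Chains are row vectors, so the boundary map is right multiplication by this matrix; a loop gives
    a zero row. *)
Definition incidence (G : graph) : 'M[int]_(nE G, nV G) :=
  \matrix_(e, v) ((v == tgt e)%:R - (v == src e)%:R).

Definition supported (G : graph) (S : {set edge G}) (c : chain G) : Prop :=
  forall e, e \notin S -> c 0 e = 0.

Lemma chain_of_cons (G : graph) (d : dart G) w :
  chain_of (d :: w) = (if d.2 then 1 else -1) *: delta_mx 0 d.1 + chain_of w.
Proof.
apply/rowP => e; rewrite !mxE big_cons eqxx /= eq_sym.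
by case: (e == d.1); rewrite ?mulr1 // mulr0 add0r.
Qed.

Lemma chain_of_boundary (G : graph) (S : {set edge G}) u w v :
  walk S u w v ->
  chain_of w *m incidence G = delta_mx 0 v - delta_mx 0 u.
Proof.
elim: w u => [|d w IH] u /=.
  move=> /eqP ->; rewrite subrr (_ : chain_of _ = 0) ?mul0mx //.
  by apply/rowP => e; rewrite !mxE big_nil.
move=> /and3P[_ /eqP <- /IH wb].
rewrite chain_of_cons mulmxDl wb -scalemxAl -rowE.
apply/rowP => x; rewrite !mxE /dsrc /dtgt eqxx /=.
by case: d.2; rewrite ?mul1r ?mulN1r ?opprB addrC addrA subrK.
Qed.

Lemma chain_of_supported (G : graph) (S : {set edge G}) u w v :
  walk S u w v -> supported S (chain_of w).
Proof.
elim: w u => [|d w IH] u /=; first by move=> _ e _; rewrite mxE big_nil.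
move=> /and3P[dS _ /IH sw] e eS; rewrite chain_of_cons.
rewrite [LHS]mxE (sw _ eS) !mxE eqxx /=.
by case: eqP eS => [->|]; rewrite ?dS // mulr0 addr0.
Qed.

Lemma chain_of_uniq_edge (G : graph) (e : edge G) w :
  (e, true) \in w -> uniq (map fst w) -> chain_of w 0 e = 1.
Proof.
move=> ew uw; have pw := perm_to_rem ew.
rewrite mxE (perm_big _ pw) big_cons eqxx big1_seq ?addr0 // => d.
move=> /andP[/eqP de dw]; move: uw; rewrite (perm_uniq (perm_map fst pw)) /=.
by case/andP => /negP[]; rewrite -[X in X \in _]de map_f.
Qed.

(** * Spanning trees and the basis of fundamental cycles *)

Section SpanningTree.
Variables (G : graph) (T : {set edge G}) (Ttree : spanning_tree T).

(** Otherwise a simple path from [tgt e] to [src e] avoiding [e] would close up with [e] to a simple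
    cycle in [T]. *)
Lemma spanning_tree_bridge e w :
  e \in T -> ~~ walk (T :\ e) (tgt e) w (src e).
Proof.
move=> eT; apply/negP => /walk_simple_path[p pP].
have /negP[] := Ttree.2 (src e) ((e, true) :: p).
have ue := simple_path_uniq_edges pP.
case/andP: pP => pw pu.
have sub (S S' : {set edge G}) u v r :
    S \subset S' -> walk S u r v -> walk S' u r v.
  move=> /fintype.subsetP sS; elim: r u => //= d r IH u /and3P[/sS -> ->].
  exact: IH.
rewrite /simple_cycle /= eT /dsrc eqxx /= (sub _ _ _ _ _ _ pw) ?subsetDl //=.
move: pu; rewrite /= => -> /=; rewrite ue andbT.
have allp r u : walk (T :\ e) u r (src e) -> e \notin map fst r.
  elim: r u => //= d r IH u /and3P[+ _ /IH]; rewrite !inE negb_or eq_sym.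
  by case/andP=> -> _ ->.
exact: allp pw.
Qed.

Lemma tree_cycle_eq0 (c : chain G) :
  supported T c -> c *m incidence G = 0 -> c = 0.
Proof.
move=> cT cD; apply/rowP => e; rewrite [RHS]mxE.
have [eT|] := boolP (e \in T); last exact: cT.
(* The indicator of the component of [tgt e] in [T] minus [e]. *)
pose f : 'cV[int]_(nV G) :=
  \col_v (`[< exists w, walk (T :\ e) (tgt e) w v >])%:R.
have Df e' : (incidence G *m f) e' 0 = f (tgt e') 0 - f (src e') 0.
  rewrite mxE; under eq_bigr => v _ do rewrite mxE mulrBl.
  rewrite big_split /= sumrN; congr (_ - _).
    rewrite (bigD1 (tgt e')) //= eqxx mul1r big1 ?addr0 // => v /negPf ->.
    by rewrite mul0r.
  rewrite (bigD1 (src e')) //= eqxx mul1r big1 ?addr0 // => v /negPf ->.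
  by rewrite mul0r.
(* Pairing [c] with the coboundary of [f] is pairing the boundary of [c] with [f], hence gives 0;
   the sum over edges will reduce to [c 0 e]. *)
have : (c *m (incidence G *m f)) 0 0 = 0 by rewrite mulmxA cD mul0mx mxE.
rewrite mxE (bigD1 e) //= big1 => [|e' e'e].
  rewrite addr0 Df !mxE asboolT; last by exists [::] => /=.
  rewrite asboolF ?subr0 ?mulr1 // => -[w].
  exact/negP/spanning_tree_bridge.
have [e'T|/cT ->] := boolP (e' \in T); last by rewrite mul0r.
rewrite Df !mxE.
(* A tree edge other than [e] has both ends in the same component of [T] minus [e], so the
   coboundary of [f] vanishes on it. *)
rewrite (_ : `[< _ >] = `[< exists w, walk (T :\ e) (tgt e) w (src e') >]).
  by rewrite subrr mulr0.
apply/asbool_equiv_eq; split=> -[w wP].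
  exists (w ++ [:: (e', false)]); apply: walk_cat wP _ => /=.
  by rewrite !inE e'e e'T /dsrc /dtgt !eqxx.
exists (w ++ [:: (e', true)]); apply: walk_cat wP _ => /=.
by rewrite !inE e'e e'T /dsrc /dtgt !eqxx.
Qed.

Lemma tree_pathP q v (c : chain G) : is_tree_path T q v c ->
  supported T c /\ c *m incidence G = delta_mx 0 v - delta_mx 0 q.
Proof.
move=> [w /andP[wP _] ->]; split; first exact: chain_of_supported wP.
exact: chain_of_boundary wP.
Qed.

Lemma fund_cycleP e (c : chain G) : is_fund_cycle T e c ->
  [/\ supported (e |: T) c, c *m incidence G = 0 & c 0 e = 1].
Proof.
move=> [u [w [/and4P[_ wP _ uw] ew ->]]]; split.
- exact: chain_of_supported wP.
- by rewrite (chain_of_boundary wP) subrr.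
- exact: chain_of_uniq_edge.
Qed.

Variable o : {set edge G} -> 'I_(genus G) -> edge G.
Hypothesis oP : cotree_order o.

Definition cotree_mx : 'M[int]_(nE G, genus G) := \matrix_(e, i) (e == o T i)%:R.

Lemma mul_cotree_mx n (Z : 'M[int]_(n, nE G)) k i :
  (Z *m cotree_mx) k i = Z k (o T i).
Proof.
rewrite mxE (bigD1 (o T i)) //= big1 ?addr0 ?mxE ?eqxx ?mulr1 // => e /negPf ne.
by rewrite mxE ne mulr0.
Qed.

Variable C : 'M[int]_(genus G, nE G).
Hypothesis Cfund : forall i, is_fund_cycle T (o T i) (row i C).

(** The only edge outside [T] that a fundamental cycle uses is its own, with coefficient 1. *)
Lemma fund_cycle_cotree : C *m cotree_mx = 1%:M.
Proof.
have [oinj omem] := oP Ttree.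
apply/matrixP => i j; rewrite mul_cotree_mx [RHS]mxE.
have [sC _ C1] := fund_cycleP (Cfund i).
case: eqP => [<-|/eqP ij]; first by rewrite mxE in C1.
have := sC (o T j); rewrite mxE => -> //.
rewrite !inE negb_or; apply/andP; split.
  by apply: contra ij => /eqP/oinj ->.
by apply/omem; exists j.
Qed.

Lemma fund_cycle_boundary : C *m incidence G = 0.
Proof.
apply/row_matrixP => i; rewrite row_mul row0.
by have [] := fund_cycleP (Cfund i).
Qed.

(** Both sides are cycles and agree off [T], since [C *m cotree_mx] is the identity; their
    difference is a cycle supported in the tree. *)
Lemma cycle_expansion n (Z : 'M[int]_(n, nE G)) :
  Z *m incidence G = 0 -> Z *m cotree_mx *m C = Z.
Proof.
move=> ZD; apply/eqP; rewrite -subr_eq0; apply/eqP/row_matrixP => k.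
rewrite row0; apply: tree_cycle_eq0; last first.
  by rewrite -row_mul mulmxBl ZD -(mulmxA (Z *m _)) fund_cycle_boundary mulmx0 subrr row0.
have [_ omem] := oP Ttree.
move=> e /omem[i <-]; rewrite mxE -mul_cotree_mx mulmxBl -(mulmxA (Z *m _)).
by rewrite fund_cycle_cotree mulmx1 subrr mxE.
Qed.

End SpanningTree.

Theorem proposition4p2 (R : realType) (Gamma : metricType R)
    (G : graph) (l : edge G -> R)
    (Gmodel : combinatorial_model l Gamma)
    (Gconn : connected_on [set: edge G])
    (Gval : forall v : vertex G, (2 <= valence v)%N)
    (o : {set edge G} -> 'I_(genus G) -> edge G)
    (oP : cotree_order o)
    (ST : {set edge G}) (STtree : spanning_tree ST)
    (q : vertex G)
    (V : 'M[R]_(genus G, nV G)) (Q : 'M[R]_(genus G))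
    (VQ : associated_mx l o ST q V Q) :
  (forall (q' : vertex G) (V' : 'M[R]_(genus G, nV G)) (Q' : 'M[R]_(genus G)),
     q' <> q -> associated_mx l o ST q' V' Q' ->
     Q' = Q /\
     exists a : 'cV[R]_(genus G),
       V' = V + a *m (const_mx 1 : 'cV[R]_(nV G))^T)
  /\
  (forall (ST' : {set edge G}) (V' : 'M[R]_(genus G, nV G))
          (Q' : 'M[R]_(genus G)),
     spanning_tree ST' -> ST' <> ST -> associated_mx l o ST' q V' Q' ->
     exists2 P : 'M[int]_(genus G), P \in unitmx &
       Q' = map_mx intr P *m Q *m (map_mx intr P)^T /\
       exists B : 'M[int]_(nV G, genus G),
         invmx (map_mx intr P) *m V' = V + Q *m (map_mx intr B)^T).
Proof.
have pathD T r (Y : 'M[int]_(nV G, nE G)) :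
    (forall i, is_tree_path T r i (row i Y)) ->
    Y *m incidence G = 1%:M - (const_mx 1 : 'cV_(nV G)) *m delta_mx 0 r.
  move=> YP; apply/row_matrixP => i.
  have [_ iD] := tree_pathP (YP i).
  rewrite row_mul iD linearB /= row1 row_mul row_const.
  by apply/rowP => x; rewrite !(mxE, big_ord1) !mul1r.
have [C [Y [CP YP -> ->]]] := VQ.
split=> [q' V' Q' _ [C' [Y' [CP' YP' -> ->]]]|ST' V' Q' ST'tree _].
  (* Expanding [C'] in the rows of [C], the coefficient matrix [C' *m cotree_mx ST o] is the
     identity. *)
  have -> : C' = C.
    rewrite -[C'](cycle_expansion STtree oP CP); last first.
      exact: fund_cycle_boundary CP'.
    by rewrite (fund_cycle_cotree STtree oP CP') mul1mx.
  (* All rows of [Y' - Y] lie in the tree and have boundary [q] minus [q'], so they coincide; row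
     [q] is the tree path from [q'] to [q]. *)
  split=> //; pose y := row q (Y' - Y).
  have -> : Y' = Y + const_mx 1 *m y.
    apply/eqP; rewrite addrC -subr_eq -subr_eq0; apply/eqP/row_matrixP => i.
    rewrite row0; apply: (tree_cycle_eq0 STtree).
      move=> e eT; have su j := (tree_pathP (YP j)).1 _ eT.
      have su' j := (tree_pathP (YP' j)).1 _ eT.
      move: (su i) (su' i) (su q) (su' q); rewrite !mxE big_ord1 !mxE.
      by move=> -> -> -> ->; rewrite subrr.
    rewrite -row_mul mulmxBl -mulmxA -row_mul mulmxBl (pathD _ _ _ YP).
    rewrite (pathD _ _ _ YP') [1%:M - _]addrC [1%:M - _]addrC opprD addrACA.
    rewrite addrN addr0.
    apply/rowP => j; rewrite !(mxE, big_ord1).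
    by rewrite eqxx /= !mul1r subrr.
  exists (map_mx intr C *m Lmx l *m (map_mx intr y)^T).
  rewrite map_mxD map_mxM linearD /= mulmxDr trmx_mul mulmxA.
  by congr (_ + _ *m _^T); apply/matrixP => i j; rewrite !mxE.
move=> [C' [Y' [CP' YP' -> ->]]].
pose P := C' *m cotree_mx ST o.
have PC : P *m C = C'.
  apply: (cycle_expansion STtree oP CP).
  exact: fund_cycle_boundary CP'.
(* The inverse is the change of basis in the other direction, so it is integral. *)
have Pinv : P *m (C *m cotree_mx ST' o) = 1%:M.
  by rewrite mulmxA PC; apply: fund_cycle_cotree.
pose PR : 'M[R]_(genus G) := map_mx intr P.
have PRunit : PR \in unitmx.
  have : PR *m map_mx intr (C *m cotree_mx ST' o) = 1%:M.
    by rewrite -map_mxM Pinv map_mx1.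
  by case/mulmx1_unit.
exists P; first by have [] := mulmx1_unit Pinv.
rewrite -/PR -PC map_mxM -/PR; split.
  by rewrite trmx_mul !mulmxA.
(* With a common root, the two paths to a vertex differ by a cycle; [B] holds its coordinates in the
   basis [C]. *)
pose B := (Y' - Y) *m cotree_mx ST o; exists B.
have -> : Y' = Y + B *m C.
  rewrite (cycle_expansion STtree oP CP) ?[Y + _]addrC ?subrK //.
  by rewrite mulmxBl (pathD _ _ _ YP) (pathD _ _ _ YP') subrr.
(* Substituting [P *m C] and [Y + B *m C], the factor [P] cancels and the second summand contains C
   L C^T, which is [Q]. *)
rewrite map_mxD map_mxM linearD /= mulmxDr trmx_mul mulmxDr.
by rewrite !mulmxA !mulVmx // !mul1mx.
Qed.
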